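(* For all positive integers $u,v$, $\Phi(u\times v,4,2)\le J^*(u\times v)$.
   Context: A 2-D $(u\times v,4,2)$-OOC is a family $\mathcal C$ of $u\times v$ $(0,1)$-matrices of Hamming weight $4$ such that for all $A=(a_{ij}),B=(b_{ij})\in\mathcal C$ and integers $r$ with $A\ne B$ or $r\not\equiv0\pmod v$, $\sum_{i,j}a_{ij}b_{i,j+r}\le 2$ (column indices mod $v$). $\Phi(u\times v,4,2)$ is the largest size of such a code. Write $N=\lfloor\frac{uv-1}{3}\lfloor\frac{uv-2}{2}\rfloor\rfloor$. Let $A=\{(u,v):u\equiv0\ (\mathrm{mod}\ 12),\ v\equiv2,4\ (\mathrm{mod}\ 6)\}$ and $B=\{(u,v):uv\equiv0\ (\mathrm{mod}\ 12),\ v\equiv0\ (\mathrm{mod}\ 6)\}$. Define $J^*(u\times v)$ as: $\lfloor\frac{u}{4}N\rfloor-1$ if $u\equiv7,11\pmod{12}$ and $v=2$; $\lfloor\frac{u}{4}(N-1)\rfloor$ if either ($uv\equiv0\pmod 6$ and $(u,v)\notin A\cup B$) or ($uv\equiv4,8\pmod{12}$ and $v$ even); $\lfloor\frac{u}{4}(N-1)\rfloor-1$ if $(u,v)\in A$; $\lfloor\frac{u}{4}(N-2)\rfloor$ if $(u,v)\in B$; and $\lfloor\frac{u}{4}N\rfloor$ otherwise. *)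

(* Defs.v *)
From mathcomp Require Import all_boot all_order all_algebra.
Set Implicit Arguments. Unset Strict Implicit. Unset Printing Implicit Defensive.

Lemma shift_lt (v : nat) (j r : 'I_v) : (j + r) %% v < v.
Proof. by rewrite ltn_pmod // (leq_ltn_trans (leq0n j) (ltn_ord j)). Qed.

Definition colshift (v : nat) (j r : 'I_v) : 'I_v := Ordinal (shift_lt j r).

Definition hweight (u v : nat) (A : 'M[bool]_(u, v)) : nat :=
  \sum_(i < u) \sum_(j < v) (A i j : nat).

Definition corr (u v : nat) (A B : 'M[bool]_(u, v)) (r : 'I_v) : nat :=
  \sum_(i < u) \sum_(j < v) ((A i j && B i (colshift j r)) : nat).

(* A 2-D (u x v, 4, 2)-OOC: every shift r in Z is represented mod v by r : 'I_v,
   and r = 0 mod v iff r = 0 as an ordinal. *)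
Definition is_OOC (u v : nat) (C : {set 'M[bool]_(u, v)}) : bool :=
  [forall A in C, hweight A == 4] &&
  [forall A in C, forall B in C, forall r : 'I_v,
      ((A != B) || (r != 0 :> nat)) ==> (corr A B r <= 2)].

(* Largest size of such a code (the empty code is always an OOC). *)
Definition Phi (u v : nat) : nat :=
  \max_(C : {set 'M[bool]_(u, v)} | is_OOC C) #|C|.

Definition Nval (u v : nat) : nat := ((u * v - 1) * ((u * v - 2) %/ 2)) %/ 3.

Definition inA (u v : nat) : bool := (u %% 12 == 0) && ((v %% 6 == 2) || (v %% 6 == 4)).
Definition inB (u v : nat) : bool := (u * v %% 12 == 0) && (v %% 6 == 0).

Definition Jstar (u v : nat) : nat :=
  let N := Nval u v in
  if ((u %% 12 == 7) || (u %% 12 == 11)) && (v == 2) then (u * N) %/ 4 - 1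
  else if ((u * v %% 6 == 0) && ~~ (inA u v || inB u v))
          || (((u * v %% 12 == 4) || (u * v %% 12 == 8)) && ~~ odd v)
       then (u * (N - 1)) %/ 4
  else if inA u v then (u * (N - 1)) %/ 4 - 1
  else if inB u v then (u * (N - 2)) %/ 4
  else (u * N) %/ 4.

(* Main.v *)
Require Import Defs.
From mathcomp Require Import all_boot all_order all_algebra.
From mathcomp Require Import zify.

Set Implicit Arguments. Unset Strict Implicit. Unset Printing Implicit Defensive.
Import GRing.Theory.

(** The v cyclic shifts of the codewords form a family of quadruples on the
    n = uv points, any two of which share at most two points. If r_x denotes the
    number of quadruples through x, then sum_x r_x = 4 v |C|, so bounds for the
    r_x give bounds for |C|. For a point x, the triples {x, p, q} contained in no
    quadruple are the edges of a graph L_x, the link of x, whose degrees sum to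
    (n - 1)(n - 2) - 6 r_x; if n is even, all degrees of L_x are even.
    If 6 divides n, the degree sum is 2 mod 6, and 2 is impossible for an even
    simple graph, so it is at least 8. If v is even, x |-> x + v/2 permutes the
    quadruples through x and x + v/2 without fixed quadruple, so x + v/2 has
    degree n - 2 mod 4 in L_x. If 12 divides n and the degree sum is 8, then L_x
    is a 4-cycle through x + v/2. Each of its edges has exactly one end adjacent
    to x + v/2, and the neighbours of x + v/2 are permuted by the shift by v/2, so
    no edge joins two points that differ by v/2. A neighbour a of x + v/2 in L_x
    has the edge {x, x + v/2} in L_a, so L_a is not of this kind. When 3 divides v,
    the triple {x, x + v/3, x + 2v/3} is in no quadruple, which provides such an a
    in the orbit of x under the shift by v/3, where r_a = r_x. For v = 2 and
    u = 7, 11 mod 12, attaining the bound would confine the uncovered triples to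
    four points, where the congruence modulo 4 excludes them. *)

Lemma sum_mem (T : finType) (A B : {set T}) :
  \sum_(x in A) (x \in B : nat) = #|A :&: B|.
Proof. by rewrite -big_mkcondr sum1_card; apply: eq_card => x; rewrite inE. Qed.

Lemma involution_card_even (T : finType) (f : T -> T) (A : {set T}) :
  involutive f -> {in A, forall x, f x \in A} -> {in A, forall x, f x != x} ->
  ~~ odd #|A|.
Proof.
move=> fK fA f_neq; suff <- : fcard f A * 2 = #|A| by rewrite oddM andbF.
apply: fcard_order_set; first exact: inv_inj.
  apply/subsetP => x xA; rewrite inE; apply/eqP.
  by apply: (@order_cycle _ f [:: x; f x]);
    rewrite /= ?fK ?eqxx ?mem_head // inE eq_sym f_neq.
move=> x _ /eqP <-; apply/idP/idP => [/fA //|/fA].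
by rewrite fK.
Qed.

(** * Simple graphs with even degrees *)

Section SimpleGraph.
Variables (T : finType) (g : rel T).

Definition nbr p : {set T} := [set q | g p q].
Definition deg p : nat := #|nbr p|.
Definition degsum : nat := \sum_p deg p.
Definition nonisolated : {set T} := [set p | 0 < deg p].

Definition simple_graph : Prop := symmetric g /\ irreflexive g.

Lemma edge_nonisolated p q : g p q -> p \in nonisolated.
Proof. by move=> gpq; rewrite inE; apply/card_gt0P; exists q; rewrite inE. Qed.

Lemma degsum_gt0 : (0 < degsum) = (nonisolated != set0).
Proof.
rewrite lt0n sum_nat_eq0 negb_forall; apply/existsP/set0Pn => -[p].
  by rewrite -lt0n; exists p; rewrite inE.
by rewrite inE lt0n; exists p.
Qed.

Hypothesis g_simple : simple_graph.

Let gC : symmetric g. Proof. exact: g_simple.1. Qed.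
Let gI : irreflexive g. Proof. exact: g_simple.2. Qed.

Lemma nbr_nonisolated p : nbr p \subset nonisolated :\ p.
Proof.
apply/subsetP => q; rewrite inE => gpq; rewrite in_setD1.
rewrite (@edge_nonisolated q p) 1?gC // andbT.
by apply: contraTneq gpq => ->; rewrite gI.
Qed.

Lemma deg_lt_card_nonisolated p : p \in nonisolated -> deg p < #|nonisolated|.
Proof.
by move=> pN; rewrite (cardsD1 p) pN ltnS subset_leq_card ?nbr_nonisolated.
Qed.

Section EvenDegrees.
Hypothesis deg_even : forall p, ~~ odd (deg p).

Lemma deg_ge2 p : p \in nonisolated -> 2 <= deg p.
Proof. by rewrite inE; have := deg_even p; lia. Qed.

Lemma card_nonisolated_ge3 p : p \in nonisolated -> 3 <= #|nonisolated|.
Proof.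
by move=> pN; apply: leq_ltn_trans (deg_ge2 pN) (deg_lt_card_nonisolated pN).
Qed.

Lemma degsum_ge_card_nonisolated : #|nonisolated| * 2 <= degsum.
Proof.
rewrite -sum_nat_const /degsum [leqRHS](bigID (mem nonisolated)) /=.
by apply: leq_trans (leq_addr _ _); apply: leq_sum => p /deg_ge2.
Qed.

Lemma degsum_ge6 : 0 < degsum -> 6 <= degsum.
Proof.
rewrite degsum_gt0 => /set0Pn[p /card_nonisolated_ge3 ge3].
by have := degsum_ge_card_nonisolated; lia.
Qed.

(* A graph with even degrees summing to 8 is a 4-cycle and isolated vertices. *)
Section FourCycle.
Hypothesis degsum8 : degsum = 8.

Lemma four_cycle_deg p : p \in nonisolated -> deg p = 2.
Proof.
move=> pN; have := deg_ge2 pN; have := deg_even p.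
by have := deg_lt_card_nonisolated pN; have := degsum_ge_card_nonisolated; lia.
Qed.

Lemma four_cycle_card : #|nonisolated| = 4.
Proof.
have : \sum_(p in nonisolated) deg p = 8.
  rewrite -degsum8 /degsum [RHS](bigID (mem nonisolated)) /= [X in _ + X]big1 ?addn0 //.
  by move=> p; rewrite inE -eqn0Ngt => /eqP.
by rewrite (eq_bigr _ four_cycle_deg) sum_nat_const; lia.
Qed.

Lemma four_cycle_nbr p q : p \in nonisolated -> q \in nonisolated -> p != q ->
  g p q = false -> nbr p = nonisolated :\: [set p; q].
Proof.
move=> pN qN pq gpq; apply/eqP; rewrite eqEcard -/(deg p) four_cycle_deg //.
apply/andP; split; first by rewrite -setDDl subsetD1 nbr_nonisolated inE gpq.
have /setIidPr pqN : [set p; q] \subset nonisolated by rewrite subUset !sub1set pN.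
by rewrite cardsD pqN four_cycle_card cards2 pq.
Qed.

Lemma four_cycle_nonadjacent p : p \in nonisolated ->
  exists q, [/\ q \in nonisolated, p != q & g p q = false].
Proof.
move=> pN; have : 0 < #|nonisolated :\ p :\: nbr p|.
  rewrite cardsD (setIidPr (nbr_nonisolated p)) -/(deg p) four_cycle_deg //.
  by have := cardsD1 p nonisolated; rewrite pN four_cycle_card; lia.
case/card_gt0P => q; rewrite !inE => /and3P[/negbTE gpq qp qN].
by exists q; rewrite inE eq_sym.
Qed.

Lemma four_cycle_edge p x y : p \in nonisolated -> g x y -> g p x (+) g p y.
Proof.
move=> pN gxy; have [q [qN pq gpq]] := four_cycle_nonadjacent pN.
(* [q] is opposite to [p] in the cycle, so it has the same neighbours. *)
have adjE w : g p w = (w \in nonisolated :\: [set p; q]).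
  by rewrite -four_cycle_nbr // inE.
have adj_q w : g q w = g p w.
  by rewrite adjE setUC -(four_cycle_nbr qN pN) ?inE // 1?eq_sym // gC.
have gyx : g y x by rewrite gC.
have no_triangle : ~~ (g p x && g p y).
  apply/negP => /andP[gpx gpy]; suff : 3 <= deg x.
    by rewrite four_cycle_deg ?(edge_nonisolated gxy).
  have -> : 3 = #|[set y; p; q]|.
    rewrite -setUA cardsU1 cards2 pq !inE negb_or.
    by rewrite !(contraTneq _ gpy) // => ->; rewrite ?adj_q ?gI ?gpq.
  apply/subset_leq_card/subsetP => w; rewrite !inE.
  by move=> /orP[/orP[]|] /eqP -> //; rewrite gC ?adj_q.
have meets_nbr : g p x || g p y.
  rewrite !adjE !in_setD (edge_nonisolated gxy) (edge_nonisolated gyx).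
  rewrite !andbT -negb_and !inE.
  apply/negP => /andP[/orP[] /eqP ex /orP[] /eqP ey]; move: gxy; rewrite ex ey;
    by rewrite ?gI ?adj_q ?gI ?gpq.
by move: no_triangle meets_nbr; case: (g p x); case: (g p y).
Qed.

End FourCycle.
End EvenDegrees.
End SimpleGraph.

(** * Blocks meeting pairwise in at most two points *)

Definition triple_packing (T : finType) (k : nat) (Bs : {set {set T}}) : Prop :=
  {in Bs, forall B : {set T}, #|B| = k} /\
  {in Bs &, forall B B' : {set T}, B != B' -> #|B :&: B'| <= 2}.

Definition johnson_bound (k n : nat) : nat :=
  ((n - 1) * ((n - 2) %/ (k - 2))) %/ (k - 1).

Section Blocks.
Variables (T : finType) (Bs : {set {set T}}).

Definition through (A : {set T}) : {set {set T}} := [set B in Bs | A \subset B].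
Definition repl x : nat := #|through [set x]|.
Definition uncovered (A : {set T}) : bool := (#|A| == 3) && (through A == set0).
Definition leave_link x : rel T := fun p q => uncovered [set x; p; q].

Lemma leave_linkC x : symmetric (leave_link x).
Proof. by move=> p q; rewrite /leave_link setUAC. Qed.

Lemma leave_linkCA x p q : leave_link x p q = leave_link p x q.
Proof. by rewrite /leave_link (setUC [set x]). Qed.

Lemma leave_linkxx x p : leave_link x x p = false.
Proof. by rewrite /leave_link /uncovered setUid cards2; case: (x != p). Qed.

Lemma leave_link_irr x : irreflexive (leave_link x).
Proof. by move=> p; rewrite leave_linkCA leave_linkC leave_linkxx. Qed.

Lemma leave_link_simple x : simple_graph (leave_link x).
Proof. by split; [apply: leave_linkC | apply: leave_link_irr]. Qed.

Lemma deg_leave_linkxx x : deg (leave_link x) x = 0.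
Proof. by apply: eq_card0 => q; rewrite !inE leave_linkxx. Qed.

Definition leave_points : {set T} := [set x | 0 < degsum (leave_link x)].

Lemma leave_pointsP x : reflect (exists p q, leave_link x p q) (x \in leave_points).
Proof.
rewrite inE degsum_gt0; apply: (iffP (set0Pn _)) => [[p]|[p [q xpq]]].
  by rewrite inE => /card_gt0P[q]; rewrite inE; exists p, q.
by exists p; apply: edge_nonisolated xpq.
Qed.

Lemma nonisolated_leave_points x : nonisolated (leave_link x) \subset leave_points :\ x.
Proof.
rewrite subsetD1 inE deg_leave_linkxx ltnn andbT; apply/subsetP => p.
rewrite inE => /card_gt0P[q]; rewrite inE leave_linkCA => xpq.
by apply/leave_pointsP; exists x, q.
Qed.

Section Packing.
Variable k : nat.
Hypothesis packingBs : triple_packing k Bs.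

Lemma sum_card_throughU1 (A : {set T}) :
  \sum_(q in ~: A) #|through (q |: A)| = #|through A| * (k - #|A|).
Proof.
transitivity (\sum_(q in ~: A) \sum_(B in through A) (q \in B : nat)).
  apply: eq_bigr => q _; rewrite -big_mkcondr -sum1_card; apply: eq_bigl => B.
  by rewrite !inE subUset sub1set (andbC (q \in B)) andbA.
rewrite exchange_big -sum_nat_const; apply: eq_bigr => B; rewrite inE => /andP[BBs AB].
by rewrite sum_mem setIC -setDE cardsD (setIidPr AB) packingBs.1.
Qed.

Lemma sum_repl : \sum_x repl x = #|Bs| * k.
Proof.
have := sum_card_throughU1 set0; rewrite cards0 subn0.
have -> : through set0 = Bs by apply/setP => B; rewrite inE sub0set andbT.
by move=> <-; apply: eq_big => [x|x _]; rewrite ?setU0 // !inE.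
Qed.

Lemma card_through_le1 (A : {set T}) : 2 < #|A| -> #|through A| <= 1.
Proof.
move=> A_gt2; apply/card_le1_eqP => B' B; rewrite !inE => /andP[BBs' AB'] /andP[BBs AB].
apply/eqP; apply: contraTT A_gt2 => BB'; rewrite -leqNgt.
apply: leq_trans (packingBs.2 _ _ BBs BBs' BB').
by rewrite subset_leq_card // subsetI AB.
Qed.

Lemma uncovered_through (A : {set T}) : #|A| = 3 -> uncovered A + #|through A| = 1.
Proof.
move=> cardA; rewrite /uncovered cardA -cards_eq0.
by have := @card_through_le1 A; rewrite cardA; case: #|_| => [|[]] // n /(_ isT).
Qed.

Lemma deg_leave_link x p : x != p ->
  deg (leave_link x) p + #|through [set x; p]| * (k - 2) = #|T| - 2.
Proof.
move=> xp; have card_xp : #|[set x; p]| = 2 by rewrite cards2 xp.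
rewrite -{1}card_xp -sum_card_throughU1.
have -> : #|T| - 2 = \sum_(q in ~: [set x; p]) 1.
  by rewrite sum1_card cardsCs setCK card_xp.
have -> : deg (leave_link x) p = \sum_(q in ~: [set x; p]) (q \in nbr (leave_link x) p).
  rewrite sum_mem (setIidPr _) //; apply/subsetP => q; rewrite !inE.
  apply: contraTN => /orP[] /eqP->; rewrite ?leave_link_irr //.
  by rewrite leave_linkC leave_linkxx.
rewrite -big_split; apply: eq_bigr => q; rewrite inE => q_xp.
rewrite inE /leave_link [[set x; p; q]]setUC /=; apply: uncovered_through.
by rewrite cardsU1 card_xp q_xp.
Qed.

Lemma sum_card_through2 x : \sum_(p | p != x) #|through [set x; p]| = repl x * (k - 1).
Proof.
have := sum_card_throughU1 [set x]; rewrite cards1 => <-.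
by apply: eq_big => [p|p _]; rewrite ?inE // setUC.
Qed.

Lemma degsum_leave_link x :
  degsum (leave_link x) + repl x * (k - 1) * (k - 2) = (#|T| - 1) * (#|T| - 2).
Proof.
rewrite /degsum (bigD1 x) //= deg_leave_linkxx -sum_card_through2 big_distrl.
rewrite -big_split /= subn1 -(cardC1 x) -sum_nat_const.
by apply: eq_bigr => p px; rewrite deg_leave_link // eq_sym.
Qed.

Lemma repl_le_johnson x : 2 < k -> repl x <= johnson_bound k #|T|.
Proof.
move=> k_gt2; rewrite leq_divRL -?sum_card_through2; last by lia.
rewrite subn1 -(cardC1 x) -sum_nat_const; apply: leq_sum => p px.
rewrite leq_divRL; last by lia.
by rewrite -(@deg_leave_link x p) ?leq_addl // eq_sym.
Qed.

End Packing.

Definition automorphism (f : T -> T) : Prop :=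
  injective f /\ {in Bs, forall B : {set T}, f @: B \in Bs}.

Section Automorphism.
Variable f : T -> T.
Hypothesis f_aut : automorphism f.

Let f_inj : injective f. Proof. exact: f_aut.1. Qed.
Let f_blocks : {in Bs, forall B : {set T}, f @: B \in Bs}. Proof. exact: f_aut.2. Qed.

Lemma through_imset (A : {set T}) :
  through (f @: A) = [set f @: B | B : {set T} in through A].
Proof.
have BsE : [set f @: B | B : {set T} in Bs] = Bs.
  apply/eqP; rewrite eqEcard card_imset; last exact: imset_inj.
  by rewrite leqnn andbT; apply/subsetP => _ /imsetP[B BBs ->]; apply: f_blocks.
apply/setP => B; apply/idP/imsetP => [|[B' + ->]]; rewrite !inE.
  rewrite -{1}BsE => /andP[/imsetP[B' BBs' ->]]; rewrite sub_imset_pre => AB'.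
  exists B' => //; rewrite inE BBs'; apply: subset_trans AB' _.
  by apply/subsetP => x; rewrite inE mem_imset.
by case/andP=> BBs' AB'; rewrite f_blocks // imsetS.
Qed.

Lemma repl_automorphism x : repl (f x) = repl x.
Proof. by rewrite /repl -imset_set1 through_imset card_imset //; apply: imset_inj. Qed.

Lemma leave_link_automorphism x p q :
  leave_link (f x) (f p) (f q) = leave_link x p q.
Proof.
rewrite /leave_link /uncovered -!imset_set1 -!imsetU card_imset // through_imset.
by rewrite -!cards_eq0 [in LHS]card_imset //; apply: imset_inj.
Qed.

End Automorphism.

Definition free_automorphism (f : T -> T) : Prop :=
  [/\ automorphism f, forall x, f x != x & {in Bs, forall B : {set T}, f @: B != B}].

Section FreeAutomorphism.
Variables (k : nat) (f : T -> T).
Hypotheses (packingBs : triple_packing k Bs) (f_free : free_automorphism f).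

Let f_aut : automorphism f. Proof. by case: f_free. Qed.
Let f_neq x : f x != x. Proof. by case: f_free. Qed.
Let f_block_neq : {in Bs, forall B : {set T}, f @: B != B}. Proof. by case: f_free. Qed.

Lemma card_through_involution_even x :
  involutive f -> ~~ odd #|through [set x; f x]|.
Proof.
move=> fK; have pairE : f @: [set x; f x] = [set x; f x].
  by rewrite imsetU1 imset_set1 fK setUC.
apply: (@involution_card_even _ (fun B : {set T} => f @: B)) => [B|B|B].
- by rewrite -imset_comp -[RHS]imset_id; apply: eq_imset => z /=; rewrite fK.
- by rewrite !inE => /andP[BBs xB]; rewrite f_aut.2 //= -{1}pairE imsetS.
- by rewrite inE => /andP[BBs _]; apply: f_block_neq.
Qed.

Lemma deg_leave_link_involution x : involutive f ->
  deg (leave_link x) (f x) = #|T| - 2 %[mod 2 * (k - 2)].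
Proof.
move=> fK; have := deg_leave_link packingBs (x := x) (p := f x).
rewrite eq_sym f_neq => <- //.
have := odd_double_half #|through [set x; f x]|.
rewrite (negbTE (card_through_involution_even x fK)) add0n => <-.
by rewrite -muln2 -mulnA addnC modnMDl.
Qed.

Lemma leave_link_order3 x : (forall y, f (f (f y)) = y) -> leave_link x (f x) (f (f x)).
Proof.
move=> f3; pose orbit := [set x; f x; f (f x)].
have card_orbit : #|orbit| = 3.
  rewrite /orbit -setUA cardsU1 cards2 !inE negb_or (eq_sym (f x)) f_neq.
  by rewrite eq_sym f_neq -{1}(f3 x) f_neq.
have orbitE : f @: orbit = orbit by rewrite !imsetU !imset_set1 f3 setUC setUA.
rewrite /leave_link /uncovered card_orbit -subset0; apply/subsetP => B B_orbit.
have fB_orbit : f @: B \in through orbit.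
  by rewrite -orbitE through_imset // imset_f.
have /card_le1_eqP/(_ _ _ B_orbit fB_orbit)/eqP : #|through orbit| <= 1.
  by apply: card_through_le1 packingBs _ _; rewrite card_orbit.
by rewrite (negbTE (f_block_neq _)) //; move: B_orbit; rewrite inE => /andP[].
Qed.

End FreeAutomorphism.
End Blocks.

(** * Quadruples *)

Lemma johnson_bound4_even n : ~~ odd n -> johnson_bound 4 n = ((n - 1) * (n - 2)) %/ 6.
Proof.
by move=> n_even; rewrite /johnson_bound muln_divA -?divnMA // /dvdn; lia.
Qed.

Section QuadruplePacking.
Variables (T : finType) (Bs : {set {set T}}).
Hypothesis packing4 : triple_packing 4 Bs.

Local Notation n := #|T|.
Local Notation N := (johnson_bound 4 n).
Local Notation link := (leave_link Bs).
Local Notation leave_points := (leave_points Bs).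

Lemma deg_leave_link_even x : ~~ odd n -> forall p, ~~ odd (deg (link x) p).
Proof.
move=> n_even p; have [<-|xp] := eqVneq x p; first by rewrite deg_leave_linkxx.
by have := deg_leave_link packing4 xp; lia.
Qed.

Lemma degsum_deficit x : ~~ odd n ->
  degsum (link x) = 6 * (N - repl Bs x) + ((n - 1) * (n - 2)) %% 6.
Proof.
move=> n_even; have := degsum_leave_link packing4 x.
have := repl_le_johnson packing4 x isT; rewrite johnson_bound4_even //.
by have := divn_eq ((n - 1) * (n - 2)) 6; lia.
Qed.

Lemma degsum_deficit_dvd6 x : 6 %| n -> degsum (link x) = 6 * (N - repl Bs x) + 2.
Proof.
move=> dvd6n; have n_gt0 : 0 < n by apply/card_gt0P; exists x.
rewrite degsum_deficit; last by lia.
have [m ->] : exists m, n = 6 * m + 6 by exists (n %/ 6 - 1); lia.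
by congr (_ + _); nia.
Qed.

Lemma degsum_deficit_ndvd3 x : ~~ odd n -> ~~ (3 %| n) ->
  degsum (link x) = 6 * (N - repl Bs x).
Proof.
move=> n_even ndvd3n; rewrite degsum_deficit // -[RHS]addn0; congr (_ + _).
by apply/eqP; rewrite -/(dvdn 6 _) (@Gauss_dvd 2 3) // Euclid_dvdM //; nia.
Qed.

Lemma repl_lt_dvd6 x : 6 %| n -> repl Bs x < N.
Proof.
move=> dvd6n; have n_even : ~~ odd n by lia.
have := degsum_ge6 (leave_link_simple Bs x) (deg_leave_link_even x n_even).
by rewrite degsum_deficit_dvd6 //; lia.
Qed.

Lemma degsum_eq8 x : 6 %| n -> N - 1 <= repl Bs x -> degsum (link x) = 8.
Proof.
move=> dvd6n le_repl; have := repl_lt_dvd6 x dvd6n.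
by rewrite degsum_deficit_dvd6 //; lia.
Qed.

Section FreeInvolution.
Variable s : T -> T.
Hypotheses (s_free : free_automorphism Bs s) (sK : involutive s).

Let s_aut : automorphism Bs s. Proof. by case: s_free. Qed.

Lemma deg_partner_mod4 x : deg (link x) (s x) = n - 2 %[mod 4].
Proof. exact: deg_leave_link_involution packing4 s_free x sK. Qed.

Lemma leave_link_partner x q : link x (s x) (s q) = link x (s x) q.
Proof. by rewrite leave_linkCA -{2}(sK x) (leave_link_automorphism s_aut). Qed.

Lemma partner_nonisolated x : 4 %| n -> s x \in nonisolated (link x).
Proof.
move=> dvd4n; have n_gt0 : 0 < n by apply/card_gt0P; exists x.
by rewrite inE; have := deg_partner_mod4 x; lia.
Qed.

Lemma repl_lt_dvd4 x : 4 %| n -> ~~ (3 %| n) -> repl Bs x < N.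
Proof.
move=> dvd4n ndvd3n; have : 0 < degsum (link x).
  by rewrite degsum_gt0; apply/set0Pn; exists (s x); apply: partner_nonisolated.
by rewrite degsum_deficit_ndvd3 //; lia.
Qed.

Lemma degsum8_partner_edge x p q : 4 %| n -> degsum (link x) = 8 ->
  link x p q -> link x (s x) p (+) link x (s x) q.
Proof.
move=> dvd4n degsum8; apply: four_cycle_edge => //; first exact: leave_link_simple.
- by apply: deg_leave_link_even; lia.
- exact: partner_nonisolated.
Qed.

Lemma partner_nbr_degsum_neq8 x a : 4 %| n -> link x (s x) a -> degsum (link a) != 8.
Proof.
move=> dvd4n xa; apply/eqP => /(degsum8_partner_edge dvd4n) no_edge.
have /no_edge : link a x (s x) by rewrite leave_linkCA leave_linkC.
by rewrite leave_link_partner addbb.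
Qed.

Lemma exists_repl_lt_dvd12 (x : T) : 12 %| n -> exists y, repl Bs y < N - 1.
Proof.
move=> dvd12n; have [dvd6n dvd4n] : 6 %| n /\ 4 %| n by lia.
have := partner_nonisolated x dvd4n; rewrite inE => /card_gt0P[a].
rewrite inE => /(partner_nbr_degsum_neq8 dvd4n) a_neq8; exists a.
by rewrite ltnNge; apply: contra a_neq8 => /(degsum_eq8 dvd6n) ->.
Qed.

Lemma repl_lt_dvd12_order3 (t : T -> T) x :
  free_automorphism Bs t -> (forall y, t (t (t y)) = y) ->
  12 %| n -> repl Bs x < N - 1.
Proof.
move=> t_free t3 dvd12n; have [dvd6n dvd4n] : 6 %| n /\ 4 %| n by lia.
have repl_t y : repl Bs (t y) = repl Bs y.
  by have [t_aut _ _] := t_free; apply: repl_automorphism.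
rewrite ltnNge; apply/negP => le_repl.
have orbit_eq8 a : repl Bs a = repl Bs x -> degsum (link a) = 8.
  by move=> repl_a; apply: degsum_eq8; rewrite ?repl_a.
have orbit_nonadj a : repl Bs a = repl Bs x -> link x (s x) a = false.
  by move=> /orbit_eq8 a8; apply: contra_eqF a8 => /(partner_nbr_degsum_neq8 dvd4n).
have := leave_link_order3 packing4 t_free x t3.
move/(degsum8_partner_edge dvd4n (orbit_eq8 x erefl)).
by rewrite !orbit_nonadj ?repl_t.
Qed.

(* If only four points were in uncovered triples, the link of such a point [x]
   would have degree 2 at [s x], but this degree is divisible by 4. *)
Lemma card_leave_points_gt4 x :
  n %% 4 = 2 -> x \in leave_points -> 4 < #|leave_points|.
Proof.
move=> n_mod4 xL; have n_even : ~~ odd n by lia.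
rewrite ltnNge; apply/negP => card_le4.
have /leave_pointsP[p [q xpq]] := xL.
have card_ge3 := card_nonisolated_ge3 (leave_link_simple Bs x)
  (deg_leave_link_even x n_even) (edge_nonisolated xpq).
have cardL := cardsD1 x leave_points; rewrite xL in cardL.
have nonisoE : nonisolated (link x) = leave_points :\ x.
  by apply/eqP; rewrite eqEcard nonisolated_leave_points; lia.
have sx_noniso : s x \in nonisolated (link x).
  have [_ s_neq _] := s_free; rewrite nonisoE in_setD1 s_neq; apply/leave_pointsP.
  by exists (s p), (s q); rewrite (leave_link_automorphism s_aut).
have deg_lt := deg_lt_card_nonisolated (leave_link_simple Bs x) sx_noniso.
rewrite nonisoE in deg_lt; rewrite inE in sx_noniso.
by have := deg_partner_mod4 x; lia.
Qed.

Lemma sum_deficit_gt4 : n %% 4 = 2 -> ~~ (3 %| n) ->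
  0 < \sum_x (N - repl Bs x) -> 4 < \sum_x (N - repl Bs x).
Proof.
move=> n_mod4 ndvd3n; have leaveE x : (x \in leave_points) = (0 < N - repl Bs x).
  by rewrite inE degsum_deficit_ndvd3 ?muln_gt0 //; lia.
rewrite lt0n sum_nat_eq0 negb_forall => /existsP[x]; rewrite /= -lt0n -leaveE.
move/(card_leave_points_gt4 n_mod4) => card_gt4; apply: leq_trans card_gt4 _.
by rewrite -sum1_card big_mkcond; apply: leq_sum => y _; rewrite leaveE; case: ifP.
Qed.

End FreeInvolution.
End QuadruplePacking.

(** * Orthogonal codes *)

Lemma ord_exists_torsion v d : 1 < d -> d %| v.+1 ->
  exists2 r : 'I_v.+1, r != 0%R & (r *+ d = 0)%R.
Proof.
move=> d_gt1 dvd_d; have small : v.+1 %/ d < v.+1 by rewrite ltn_Pdiv.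
exists (Ordinal small).
  apply: contraTneq (dvdn_leq (ltn0Sn v) dvd_d) => /(congr1 val) /= quo0.
  by rewrite -divn_gt0 ?quo0 // ltnW.
by apply: val_inj; rewrite Zp_mulrn /= divnK // modnn.
Qed.

Section Code.
Variables u v : nat.
Local Notation point := ('I_u * 'I_v.+1)%type.
Local Notation word := 'M[bool]_(u, v.+1).

Definition cshift (r : 'I_v.+1) (p : point) : point := (p.1, (p.2 + r)%R).

Definition shift_block (A : word) (r : 'I_v.+1) : {set point} :=
  [set p : point | A p.1 (p.2 + r)%R].

Definition blocks (C : {set word}) : {set {set point}} :=
  [set shift_block A r | A in C, r in [set: 'I_v.+1]].

Lemma card_point : #|{: point}| = u * v.+1.
Proof. by rewrite card_prod !card_ord. Qed.

Lemma NvalE : Nval u v.+1 = johnson_bound 4 #|{: point}|.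
Proof. by rewrite card_point. Qed.

Lemma cshift0 p : cshift 0%R p = p.
Proof. by rewrite /cshift addr0 -surjective_pairing. Qed.

Lemma cshiftD r s p : cshift s (cshift r p) = cshift (r + s)%R p.
Proof. by rewrite /cshift /= addrA. Qed.

Lemma iter_cshift (r : 'I_v.+1) d p : iter d (cshift r) p = cshift (r *+ d)%R p.
Proof.
elim: d => [|d /= ->]; first by rewrite mulr0n cshift0.
by rewrite cshiftD mulrSr.
Qed.

Lemma cshift_inj r : injective (cshift r).
Proof.
by apply: (can_inj (g := cshift (- r)%R)) => p; rewrite cshiftD subrr cshift0.
Qed.

Lemma cshift_neq r p : r != 0%R -> cshift r p != p.
Proof.
apply: contraNneq => /(congr1 snd)/= /eqP.
by rewrite -subr_eq0 addrAC subrr add0r.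
Qed.

Lemma card_shift_blockI A B r s :
  #|shift_block A r :&: shift_block B s| = corr A B (s - r)%R.
Proof.
transitivity (\sum_(p : point) (A p.1 (p.2 + r)%R && B p.1 (p.2 + s)%R : nat)).
  by rewrite -sum1_card big_mkcond; apply: eq_bigr => p _; rewrite !inE; case: ifP.
rewrite -(pair_bigA _ (fun i j => A i (j + r)%R && B i (j + s)%R : nat)) /=.
apply: eq_bigr => i _.
rewrite (reindex_inj (addIr (- r)%R)); apply: eq_bigr => j _.
have -> : colshift j (s - r)%R = (j + (s - r))%R by apply: val_inj.
by rewrite addrNK -addrA (addrC (- r)%R).
Qed.

Lemma card_shift_block A r : #|shift_block A r| = hweight A.
Proof.
rewrite -[shift_block A r]setIid card_shift_blockI subrr.
apply: eq_bigr => i _; apply: eq_bigr => j _.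
have -> : colshift j 0%R = (j + 0)%R by apply: val_inj.
by rewrite addr0 andbb.
Qed.

Lemma cshift_shift_block A r s : cshift s @: shift_block A r = shift_block A (r - s)%R.
Proof.
apply/setP => p; rewrite !inE; apply/imsetP/idP => [[q]|Ap].
  by rewrite inE => Aq -> /=; rewrite addrACA subrr addr0.
exists (p.1, (p.2 - s)%R); first by rewrite inE /= -addrA (addrC (- s)%R).
by rewrite /cshift /= subrK -surjective_pairing.
Qed.

Section OOC.
Variable C : {set word}.
Hypothesis C_OOC : is_OOC C.

Lemma OOC_weight A : A \in C -> hweight A = 4.
Proof. by move=> AC; case/andP: C_OOC => /forall_inP/(_ A AC)/eqP. Qed.

Lemma OOC_corr A B (r : 'I_v.+1) : A \in C -> B \in C -> (A != B) || (r != 0%R) ->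
  corr A B r <= 2.
Proof.
move=> AC BC ABr; case/andP: C_OOC => _ /forall_inP/(_ A AC)/forall_inP/(_ B BC).
by move/forallP/(_ r)/implyP; apply.
Qed.

Lemma card_shift_blockI_le2 A B r s : A \in C -> B \in C -> (A, r) != (B, s) ->
  #|shift_block A r :&: shift_block B s| <= 2.
Proof.
move=> AC BC; rewrite xpair_eqE negb_and card_shift_blockI => ne.
by apply: OOC_corr; rewrite // subr_eq0 (eq_sym s).
Qed.

Lemma shift_block_inj : {in setX C setT &, injective (uncurry shift_block)}.
Proof.
move=> [A r] [B s]; rewrite !in_setX /= => /andP[AC _] /andP[BC _] eqAB.
apply/eqP; apply: contraT => /(card_shift_blockI_le2 AC BC).
by rewrite -eqAB setIid card_shift_block OOC_weight.
Qed.

Lemma card_blocks : #|blocks C| = #|C| * v.+1.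
Proof.
by rewrite /blocks curry_imset2X (card_in_imset shift_block_inj) cardsX cardsT card_ord.
Qed.

Lemma blocks_packing : triple_packing 4 (blocks C).
Proof.
split=> [_ /imset2P[A r AC _ ->]|]; first by rewrite card_shift_block OOC_weight.
move=> _ _ /imset2P[A r AC _ ->] /imset2P[B s BC _ ->] ne.
by apply: card_shift_blockI_le2 => //; apply: contraNneq ne => -[-> ->].
Qed.

Lemma cshift_free_automorphism r : r != 0%R -> free_automorphism (blocks C) (cshift r).
Proof.
move=> r_neq0; split=> [|p|_ /imset2P[A s AC _ ->]].
- split=> [|_ /imset2P[A s AC _ ->]]; first exact: cshift_inj.
  by rewrite cshift_shift_block imset2_f ?inE.
- exact: cshift_neq.
rewrite cshift_shift_block.
apply: contra_neq r_neq0 => /(@shift_block_inj (A, _) (A, _)).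
rewrite !in_setX /= AC !inE => /(_ isT isT)[] /eqP.
by rewrite -subr_eq0 addrAC subrr add0r oppr_eq0 => /eqP.
Qed.

Lemma exists_free_automorphism d : 1 < d -> d %| v.+1 ->
  exists2 f, free_automorphism (blocks C) f & forall p, iter d f p = p.
Proof.
move=> d_gt1 /(ord_exists_torsion d_gt1)[r r_neq0 rd].
exists (cshift r) => [|p]; first exact: cshift_free_automorphism.
by rewrite iter_cshift rd cshift0.
Qed.

Lemma sum_repl_blocks : \sum_p repl (blocks C) p = v.+1 * (#|C| * 4).
Proof. by rewrite (sum_repl blocks_packing) card_blocks mulnAC mulnC. Qed.

Lemma sum_point (M : nat) : \sum_(p : point) M = v.+1 * (u * M).
Proof. by rewrite sum_nat_const card_point mulnAC mulnC. Qed.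

Lemma card_OOC_le M : (forall p, repl (blocks C) p <= M) -> #|C| <= (u * M) %/ 4.
Proof.
move=> replM; rewrite leq_divRL // -(leq_pmul2l (ltn0Sn v)).
by rewrite -sum_repl_blocks -sum_point leq_sum.
Qed.

Lemma card_OOC_lt M q : (forall p, repl (blocks C) p <= M) -> repl (blocks C) q < M ->
  #|C| * 4 < u * M.
Proof.
move=> replM ltM; rewrite -(ltn_pmul2l (ltn0Sn v)) -sum_repl_blocks -sum_point.
rewrite (bigD1 q) //= [ltnRHS](bigD1 q) //= -addSn.
by apply: leq_add => //; apply: leq_sum.
Qed.

Lemma sum_deficit_blocks :
  \sum_p (Nval u v.+1 - repl (blocks C) p) = v.+1 * (u * Nval u v.+1 - #|C| * 4).
Proof.
rewrite sumnB => [|p _]; first by rewrite sum_point sum_repl_blocks mulnBr.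
by rewrite NvalE repl_le_johnson //; apply: blocks_packing.
Qed.

Lemma card_OOC_johnson : #|C| <= (u * Nval u v.+1) %/ 4.
Proof.
by apply: card_OOC_le => p; rewrite NvalE; apply: repl_le_johnson blocks_packing _ _.
Qed.

Lemma card_OOC_dvd6 : 6 %| u * v.+1 -> #|C| <= (u * (Nval u v.+1 - 1)) %/ 4.
Proof.
rewrite -card_point => dvd6n; apply: card_OOC_le => p.
by have := repl_lt_dvd6 blocks_packing p dvd6n; rewrite -NvalE; lia.
Qed.

Lemma card_OOC_dvd4 : 2 %| v.+1 -> 4 %| u * v.+1 -> ~~ (3 %| u * v.+1) ->
  #|C| <= (u * (Nval u v.+1 - 1)) %/ 4.
Proof.
rewrite -card_point => dvd2v dvd4n ndvd3n.
have [s s_free sK] := exists_free_automorphism (isT : 1 < 2) dvd2v.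
apply: card_OOC_le => p.
by have := repl_lt_dvd4 blocks_packing s_free sK p dvd4n ndvd3n; rewrite -NvalE; lia.
Qed.

Lemma card_OOC_dvd12_rows4 : 0 < u -> 4 %| u -> 2 %| v.+1 -> 12 %| u * v.+1 ->
  #|C| <= (u * (Nval u v.+1 - 1)) %/ 4 - 1.
Proof.
rewrite -card_point => u_gt0 dvd4u dvd2v dvd12n.
have [s s_free sK] := exists_free_automorphism (isT : 1 < 2) dvd2v.
have dvd6n : 6 %| #|{: point}| by lia.
have [q lt_q] :=
  exists_repl_lt_dvd12 blocks_packing s_free sK (Ordinal u_gt0, 0%R) dvd12n.
have : #|C| * 4 < u * (Nval u v.+1 - 1).
  apply: (card_OOC_lt (q := q)) => [p|]; last by rewrite NvalE.
  by have := repl_lt_dvd6 blocks_packing p dvd6n; rewrite -NvalE; lia.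
have : 4 %| u * (Nval u v.+1 - 1) by apply: dvdn_mulr.
by move: (u * _) => m; lia.
Qed.

Lemma card_OOC_dvd12 : 6 %| v.+1 -> 12 %| u * v.+1 ->
  #|C| <= (u * (Nval u v.+1 - 2)) %/ 4.
Proof.
rewrite -card_point => dvd6v dvd12n; have [dvd2v dvd3v] : 2 %| v.+1 /\ 3 %| v.+1 by lia.
have [s s_free sK] := exists_free_automorphism (isT : 1 < 2) dvd2v.
have [t t_free tK] := exists_free_automorphism (isT : 1 < 3) dvd3v.
apply: card_OOC_le => p.
have := repl_lt_dvd12_order3 blocks_packing s_free sK p t_free tK dvd12n.
by rewrite -NvalE; lia.
Qed.

End OOC.
End Code.

Lemma Nval_two_columns u : u %% 4 = 3 -> ~~ (3 %| u) -> Nval u 2 %% 4 = 2.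
Proof.
move=> u_mod4 ndvd3u; have -> : Nval u 2 = ((u * 2 - 1) * (u - 1)) %/ 3.
  by rewrite /Nval; congr (_ * _ %/ _); lia.
have : ((u * 2 - 1) * (u - 1)) %% 4 = 2.
  have -> : u * 2 - 1 = u %/ 4 * 2 * 4 + 5 by lia.
  have -> : u - 1 = u %/ 4 * 4 + 2 by lia.
  by rewrite -modnMm !modnMDl.
have : 3 %| (u * 2 - 1) * (u - 1) by rewrite Euclid_dvdM //; lia.
by move: (_ * _) => m; lia.
Qed.

Lemma card_OOC_two_columns u (C : {set 'M[bool]_(u, 2)}) : is_OOC C ->
  u %% 4 = 3 -> ~~ (3 %| u) -> #|C| <= (u * Nval u 2) %/ 4 - 1.
Proof.
move=> C_OOC u_mod4 ndvd3u.
have uN_mod4 : (u * Nval u 2) %% 4 = 2 by rewrite -modnMm u_mod4 Nval_two_columns.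
have C_le : #|C| <= (u * Nval u 2) %/ 4 := card_OOC_johnson C_OOC.
have [s s_free sK] := exists_free_automorphism C_OOC (isT : 1 < 2) (dvdnn 2).
have := sum_deficit_gt4 (blocks_packing C_OOC) s_free sK.
rewrite -NvalE sum_deficit_blocks // card_point => deficit_gt4.
suff : 4 < 2 * (u * Nval u 2 - #|C| * 4) by lia.
by apply: deficit_gt4; lia.
Qed.

Theorem theorem5p7 (u v : nat) (hu : 0 < u) (hv : 0 < v) :
  Phi u v <= Jstar u v.
Proof.
apply/bigmax_leqP => C; case: v hv C => // v _ C C_OOC; rewrite /Jstar.
case: ifP => [/andP[u_mod12 /eqP[v1]]|_].
  by subst v; apply: card_OOC_two_columns => //; lia.
case: ifP => [/orP[/andP[dvd6n _]|/andP[n_mod12 v_even]]|_].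
- exact: card_OOC_dvd6.
- by apply: card_OOC_dvd4 => //; lia.
case: ifP => [/andP[u_mod12 v_mod6]|_].
  by apply: card_OOC_dvd12_rows4; rewrite ?dvdn_mulr //; lia.
case: ifP => [/andP[dvd12n dvd6v]|_]; [exact: card_OOC_dvd12 | exact: card_OOC_johnson].
Qed.
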